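(* Let $A\in\mathbb{R}^{n\times n}$ be the adjacency matrix of a strongly connected, directed, unweighted network on $n$ nodes ($a_{ij}=1$ if there is an edge from $i$ to $j$, $0$ otherwise; $A$ is irreducible). Let $\lambda_1=\rho(A)$ be its Perron--Frobenius eigenvalue, and let $\mathbf{x}_L,\mathbf{x}_R$ be the left and right Perron--Frobenius eigenvectors, with positive entries, satisfying $\mathbf{x}_L^TA=\lambda_1\mathbf{x}_L^T$ and $A\mathbf{x}_R=\lambda_1\mathbf{x}_R$. Let $\mathbf{1}$ be the all-ones vector, $\mathbf{d}^{\mathrm{out}}=A\mathbf{1}$ and $\mathbf{d}^{\mathrm{in}}=A^T\mathbf{1}$. Then \[ \frac{(\mathbf{d}^{\mathrm{out}})^T\mathbf{x}_L}{\|\mathbf{d}^{\mathrm{out}}\|_1}-\frac{\|\mathbf{x}_L\|_1}{n}\ \ge\ 0 \quad\text{if and only if}\quad \lambda_1\ \ge\ \frac{\sum_{i=1}^n\sum_{j=1}^n a_{ij}}{n}, \] and likewise \[ \frac{(\mathbf{d}^{\mathrm{in}})^T\mathbf{x}_R}{\|\mathbf{d}^{\mathrm{in}}\|_1}-\frac{\|\mathbf{x}_R\|_1}{n}\ \ge\ 0 \quad\text{if and only if}\quad \lambda_1\ \ge\ \frac{\sum_{i=1}^n\sum_{j=1}^n a_{ij}}{n}. \]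
   Context: $\|\mathbf{v}\|_1=\sum_i|v_i|$. *)

(* Defs.v *)
From HB Require Import structures.
From mathcomp Require Import all_boot all_order all_algebra all_fingroup.
From mathcomp Require Import complex.
From mathcomp Require Import boolp classical_sets reals.

Set Implicit Arguments.
Unset Strict Implicit.
Unset Printing Implicit Defensive.

Import Order.TTheory GRing.Theory Num.Theory.
Local Open Scope ring_scope.
Local Open Scope complex_scope.
Local Open Scope classical_set_scope.

(* A directed unweighted network on n nodes is a relation e : rel 'I_n, where
   e i j means that there is an edge from i to j; loops are allowed. *)
Definition adjacency (R : realType) (n : nat) (e : rel 'I_n) : 'M[R]_n :=
  \matrix_(i, j) (e i j)%:R.

Definition strongly_connected (n : nat) (e : rel 'I_n) : Prop :=
  forall i j : 'I_n, connect e i j.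

(* The 1 x 1 zero matrix counts as reducible (Horn and Johnson's convention):
   the network it describes has no edge, and the quotients by the 1-norms of the
   degree vectors are undefined.  Otherwise reducibility is permutation
   similarity to a block upper triangular matrix whose diagonal blocks have
   sizes r and n - r, both positive. *)
Definition reducible (R : realType) (n : nat) (A : 'M[R]_n) : Prop :=
  (n = 1%N /\ A = 0) \/
  exists (s : 'S_n) (r : nat), (0 < r < n)%N /\
    forall i j : 'I_n, (r <= i)%N -> (j < r)%N ->
      (perm_mx s *m A *m (perm_mx s)^T) i j = 0.

Definition irreducible (R : realType) (n : nat) (A : 'M[R]_n) : Prop :=
  ~ reducible A.

(* The eigenvalues are those of A over the complex numbers R[i]; for
   n > 0 their moduli form a finite nonempty set, so the sup is a maximum. *)
Definition spectral_radius (R : realType) (n : nat) (A : 'M[R]_n) : R :=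
  sup [set ComplexField.Normc.normc z
      | z in [set z : R[i] | eigenvalue (map_mx (real_complex R) A) z]].

Definition norm1 (R : realType) (n : nat) (v : 'cV[R]_n) : R :=
  \sum_i `|v i 0|.

Definition ones (R : realType) (n : nat) : 'cV[R]_n := const_mx 1.

Definition dout (R : realType) (n : nat) (A : 'M[R]_n) : 'cV[R]_n :=
  A *m ones R n.

Definition din (R : realType) (n : nat) (A : 'M[R]_n) : 'cV[R]_n :=
  A^T *m ones R n.

Definition dotv (R : realType) (n : nat) (u v : 'cV[R]_n) : R :=
  (u^T *m v) 0 0.

(* Main.v *)
Require Import Defs.
From HB Require Import structures.
From mathcomp Require Import all_boot all_order all_algebra.
From mathcomp Require Import perm reals.

Import Order.TTheory GRing.Theory Num.Theory.
Local Open Scope ring_scope.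

(** Pairing the left eigenvector equation with the all-ones vector gives
    [dotv (dout A) xL = lambda1 * norm1 xL], while [norm1 (dout A)] is the total
    number of edges.  Dividing by [norm1 xL > 0] yields the first equivalence;
    the second one is the first one for the transposed network. *)

Lemma reducible0 (R : realType) (n : nat) : (0 < n)%N ->
  reducible (0 : 'M[R]_n).
Proof.
case: n => [//|[|n]] _; first by left.
(* From size two on, any block split exhibits the zero matrix as reducible; size one is covered by
   the convention. *)
right; exists 1%g, 1%N; split=> // i j _ _.
by rewrite mulmx0 mul0mx mxE.
Qed.

(** Were the total zero, nonnegativity would kill every row sum, then every entry, and the zero
    matrix is reducible. This keeps the norms of the degree vectors nonzero. *)
Lemma irreducible_entries_sum_gt0 (R : realType) (n : nat) (A : 'M[R]_n) :
  (0 < n)%N -> (forall i j, 0 <= A i j) -> irreducible A ->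
  0 < \sum_(i < n) \sum_(j < n) A i j.
Proof.
move=> n_gt0 A_ge0 irrA.
have row_ge0 i : 0 <= \sum_(j < n) A i j by apply: sumr_ge0.
rewrite lt_def sumr_ge0 ?andbT //; apply/negP => /eqP S0; apply: irrA.
suff -> : A = 0 by apply: reducible0.
apply/matrixP => i j; rewrite mxE.
have /psumr_eq0P Ai0 : \sum_(k < n) A i k = 0.
  by move/psumr_eq0P: S0; apply.
exact: Ai0.
Qed.

Lemma norm1_dout (R : realType) (n : nat) (A : 'M[R]_n) :
  (forall i j, 0 <= A i j) ->
  norm1 (dout A) = \sum_(i < n) \sum_(j < n) A i j.
Proof.
move=> A_ge0; apply: eq_bigr => i _.
have -> : dout A i 0 = \sum_(j < n) A i j.
  by rewrite mxE; apply: eq_bigr => j _; rewrite mxE mulr1.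
by rewrite ger0_norm ?sumr_ge0.
Qed.

Lemma dotv_dout_eigenvector (R : realType) (n : nat) (A : 'M[R]_n) (lambda : R)
    (x : 'cV[R]_n) :
  (forall i, 0 < x i 0) -> x^T *m A = lambda *: x^T ->
  dotv (dout A) x = lambda * norm1 x.
Proof.
move=> x_gt0 eigx.
have -> : dotv (dout A) x = (x^T *m A *m ones R n) 0 0.
  rewrite -mulmxA -[RHS]/((x^T *m dout A) 0 0).
  (* A 1 x 1 matrix is determined by its trace, which transposition preserves. *)
  by rewrite -[LHS]trace_mx11 -[RHS]trace_mx11 -mxtrace_tr trmx_mul trmxK.
rewrite eigx -scalemxAl !mxE; congr (_ * _).
by apply: eq_bigr => i _; rewrite !mxE mulr1 gtr0_norm.
Qed.

(** Phrased for a general nonnegative matrix so as to serve both [A] and [A^T]. *)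
Lemma dout_average_ge_iff (R : realType) (n : nat) (A : 'M[R]_n) (lambda : R)
    (x : 'cV[R]_n) :
  (0 < n)%N -> (forall i j, 0 <= A i j) ->
  0 < \sum_(i < n) \sum_(j < n) A i j ->
  (forall i, 0 < x i 0) -> x^T *m A = lambda *: x^T ->
  (dotv (dout A) x / norm1 (dout A) - norm1 x / n%:R >= 0
     <-> lambda >= (\sum_(i < n) \sum_(j < n) A i j) / n%:R).
Proof.
move=> n_gt0 A_ge0 S_gt0 x_gt0 eigx.
rewrite (dotv_dout_eigenvector _ _ _ _ _ x_gt0 eigx) norm1_dout //.
have N_gt0 : 0 < norm1 x.
  rewrite /norm1 (bigD1 (Ordinal n_gt0)) //= ltr_wpDr ?sumr_ge0 //.
  by rewrite normr_gt0 gt_eqF.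
(* Once the total of the entries is multiplied out, both sides carry the positive factor [norm1 x],
   which cancels. *)
by rewrite subr_ge0 ler_pdivlMr // mulrAC [lambda * _]mulrC -mulrA
  ler_pM2l // mulrC.
Qed.

Theorem theorem6 (R : realType) (n : nat) (e : rel 'I_n) (A : 'M[R]_n)
    (lambda1 : R) (xL xR : 'cV[R]_n) :
  (0 < n)%N ->
  strongly_connected e ->
  A = adjacency R e ->
  irreducible A ->
  lambda1 = spectral_radius A ->
  (forall i : 'I_n, 0 < xL i 0) ->
  (forall i : 'I_n, 0 < xR i 0) ->
  xL^T *m A = lambda1 *: xL^T ->
  A *m xR = lambda1 *: xR ->
  (dotv (dout A) xL / norm1 (dout A) - norm1 xL / n%:R >= 0
     <-> lambda1 >= (\sum_(i < n) \sum_(j < n) A i j) / n%:R)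
  /\
  (dotv (din A) xR / norm1 (din A) - norm1 xR / n%:R >= 0
     <-> lambda1 >= (\sum_(i < n) \sum_(j < n) A i j) / n%:R).
Proof.
move=> n_gt0 _ defA irrA _ xL_gt0 xR_gt0 eigL eigR.
have A_ge0 i j : 0 <= A i j by rewrite defA mxE ler0n.
have S_gt0 := irreducible_entries_sum_gt0 _ _ _ n_gt0 A_ge0 irrA.
split; first exact: dout_average_ge_iff.
have trS : \sum_(i < n) \sum_(j < n) A i j =
    \sum_(i < n) \sum_(j < n) A^T i j.
  rewrite exchange_big; apply: eq_bigr => i _.
  by apply: eq_bigr => j _; rewrite mxE.
(* [din A] unfolds to [dout A^T], and transposing [eigR] makes [xR] a left eigenvector of [A^T]. *)
rewrite trS; apply: (dout_average_ge_iff _ _ A^T) => //.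
- by move=> i j; rewrite mxE.
- by rewrite -trS.
- by rewrite -trmx_mul eigR linearZ.
Qed.
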